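(* Let $R$ be a GCD domain and let $G$ be a connected graph with $n$ vertices $v_1,\dots,v_n$ and edges $e_1,\dots,e_m$, whose edge labels $a_1,\dots,a_m\in R$ are nonzero and pairwise relatively prime. Put $Q=a_1\cdots a_m$, let $R_G\subseteq R^n$ be the module of generalized splines on $G$, and let $B_1,\dots,B_n\in R_G$. Then $R_G$ is free with basis $\mathcal{B}=\{B_1,\dots,B_n\}$ if and only if $\det[B_1,\dots,B_n]=uQ$ for some unit $u\in R$.
   Context: Graphs are finite, and each edge joins two distinct vertices. For a commutative ring $R$ with unity and a connected graph $G$ with vertices $v_1,\dots,v_n$, edges $e_1,\dots,e_m$ and edge labels $A=\{a_1,\dots,a_m\}\subseteq R$ ($a_k$ being the label of $e_k$), a generalized spline on $G$ over $R$ is a tuple $(f_1,\dots,f_n)\in R^n$ such that whenever $v_i$ and $v_j$ are joined by the edge $e_k$, $f_i-f_j$ lies in the ideal $\langle a_k\rangle$. The set $R_G$ of all generalized splines is an $R$-submodule of $R^n$. $[B_1,\dots,B_n]$ denotes the $n\times n$ matrix whose columns are $B_1,\dots,B_n$. A GCD domain is an integral domain in which any two elements have a greatest common divisor (defined up to units); two elements are relatively prime if their gcd is $1$ (up to units). *)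

(* Defs.v *)
From HB Require Import structures.
From mathcomp Require Import all_boot all_order all_algebra.
Set Implicit Arguments.
Unset Strict Implicit.
Unset Printing Implicit Defensive.
Import GRing.Theory.
Local Open Scope ring_scope.

(* y lies in the principal ideal <x>, i.e. x divides y. *)
Definition in_ideal (R : comNzRingType) (x y : R) : Prop :=
  exists c : R, y = c * x.

Definition is_gcd (R : comNzRingType) (x y g : R) : Prop :=
  [/\ in_ideal g x, in_ideal g y
    & forall d : R, in_ideal d x -> in_ideal d y -> in_ideal d g].

Definition gcd_domain (R : idomainType) : Prop :=
  forall x y : R, exists g : R, is_gcd x y g.

Definition rel_prime (R : comNzRingType) (x y : R) : Prop := is_gcd x y 1.

(* Parallel edges are allowed: [ends] need not be injective. *)
Record graph (n m : nat) := Graph {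
  ends : 'I_m -> {set 'I_n};
  card_ends : forall k : 'I_m, #|ends k| = 2%N
}.

Definition joins (n m : nat) (G : graph n m) (k : 'I_m) (i j : 'I_n) : bool :=
  ends G k == [set i; j].

Definition adjacent (n m : nat) (G : graph n m) : rel 'I_n :=
  fun i j => [exists k : 'I_m, joins G k i j].

(* The graph without vertices does not count as connected. *)
Definition connected (n m : nat) (G : graph n m) : Prop :=
  (0 < n)%N /\ forall i j : 'I_n, connect (adjacent G) i j.

(* The module R_G, as a predicate on R^n = 'cV[R]_n. *)
Definition spline (R : comNzRingType) (n m : nat) (G : graph n m)
    (a : 'I_m -> R) (f : 'cV[R]_n) : Prop :=
  forall (k : 'I_m) (i j : 'I_n), joins G k i j -> in_ideal (a k) (f i 0 - f j 0).

Lemma spline_submod (R : comNzRingType) (n m : nat) (G : graph n m)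
    (a : 'I_m -> R) :
  spline G a 0 /\
  forall (r : R) (f g : 'cV[R]_n),
    spline G a f -> spline G a g -> spline G a (r *: f + g).
Proof.
split=> [k i j _|r f g sf sg k i j kij]; first by exists 0; rewrite !mxE subrr mul0r.
have [c ec] := sf k i j kij; have [d ed] := sg k i j kij.
by exists (r * c + d); rewrite !mxE opprD addrACA -mulrBr ec ed mulrDl mulrA.
Qed.

(* The submodule M is free with basis the family B. *)
Definition free_with_basis (R : nzRingType) (V : lmodType R) (M : V -> Prop)
    (n : nat) (B : 'I_n -> V) : Prop :=
  [/\ forall j, M (B j),
      forall c : 'I_n -> R, \sum_j c j *: B j = 0 -> forall j, c j = 0
    & forall f : V, M f -> exists c : 'I_n -> R, f = \sum_j c j *: B j].

Definition cols_mx (R : nzRingType) (n : nat) (B : 'I_n -> 'cV[R]_n) : 'M[R]_n :=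
  \matrix_(i, j) B j i 0.

(* Main.v *)
Require Import Defs.
From HB Require Import structures.
From mathcomp Require Import all_boot all_order all_algebra.
Set Implicit Arguments.
Unset Strict Implicit.
Unset Printing Implicit Defensive.
Import GRing.Theory.
Local Open Scope ring_scope.

(** Write D for the determinant of a family of n splines and Q for the product
    of the labels.  Along an edge labelled a_k two rows of the matrix are
    congruent modulo a_k, so a_k divides D ([label_dvd_det]); as the labels are
    pairwise relatively prime in a GCD domain, Q divides D ([prod_dvd_det]).

    If D = u Q with u a unit, Cramer's rule expresses a multiple D f of a spline
    f through the family, with coefficients that are again determinants of
    families of splines.  They are multiples of Q, so that Q cancels and f itself
    is a combination of the family; independence is D != 0.

    Conversely, if the family generates all splines, D divides the determinant
    of every family of n splines ([det_generators_dvd]).  Write D = r Q and test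
    this on explicit families.  The family Q e_v, for all vertices v, gives
    r | Q^n.  For an edge k with ends p and q, put P = Q / a_k and take the
    constant spline 1 in place of e_p, the spline Q e_q, and P e_v for the other
    vertices v: the edge k imposes no condition on these last ones.  The
    determinant is a_k times a power of P, whence r divides a power of P and is
    relatively prime to a_k ([basis_cofactor_rel_prime]).  Thus r is relatively
    prime to Q and divides a power of Q, so it is a unit. *)

(** * Divisibility in GCD domains *)

Section Divisibility.
Variable R : idomainType.
Implicit Types x y z d : R.

Lemma in_ideal_refl x : in_ideal x x.
Proof. by exists 1; rewrite mul1r. Qed.

Lemma in_ideal0 x : in_ideal x 0.
Proof. by exists 0; rewrite mul0r. Qed.

Lemma in_ideal1 x : in_ideal 1 x.
Proof. by exists x; rewrite mulr1. Qed.

Lemma in_ideal_trans y x z : in_ideal x y -> in_ideal y z -> in_ideal x z.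
Proof. by case=> c -> [e ->]; exists (e * c); rewrite mulrA. Qed.

Lemma in_ideal_mull x y z : in_ideal x z -> in_ideal x (y * z).
Proof. by case=> c ->; exists (y * c); rewrite mulrA. Qed.

Lemma in_ideal_mulr x y z : in_ideal x y -> in_ideal x (y * z).
Proof. by rewrite mulrC; apply: in_ideal_mull. Qed.

Lemma in_idealB x y z : in_ideal x y -> in_ideal x z -> in_ideal x (y - z).
Proof. by case=> c -> [e ->]; exists (c - e); rewrite mulrBl. Qed.

Lemma in_ideal_prod (I : finType) (P : pred I) (F : I -> R) i :
  P i -> in_ideal (F i) (\prod_(j | P j) F j).
Proof.
by move=> Pi; rewrite (bigD1 i) //=; apply/in_ideal_mulr/in_ideal_refl.
Qed.

Lemma in_ideal1_unit x : in_ideal x 1 -> x \is a GRing.unit.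
Proof. by case=> c e; apply/unitrPr; exists c; rewrite mulrC. Qed.

Lemma rel_primeI x y :
  (forall d, in_ideal d x -> in_ideal d y -> in_ideal d 1) -> rel_prime x y.
Proof. by split=> //; apply: in_ideal1. Qed.

Lemma rel_prime_sym x y : rel_prime x y -> rel_prime y x.
Proof. by case=> _ _ h; apply: rel_primeI => d dy dx; apply: h. Qed.

Lemma rel_prime_dvdl x y z : in_ideal z x -> rel_prime x y -> rel_prime z y.
Proof.
move=> zx [_ _ h]; apply: rel_primeI => d dz dy.
exact: h (in_ideal_trans dz zx) dy.
Qed.

Lemma rel_prime1 x : rel_prime x 1.
Proof. exact: rel_primeI. Qed.

Hypothesis hR : gcd_domain R.

(** A gcd of x z and y z is associate to z: it has the form h z, and h divides
    both x and y. As x divides x z and y z, it divides this gcd. *)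
Lemma rel_prime_gauss x y z :
  rel_prime x y -> in_ideal x (y * z) -> in_ideal x z.
Proof.
move=> [_ _ cop] xyz; have [->|z0] := eqVneq z 0; first exact: in_ideal0.
have [g [gx gy gmax]] := hR (x * z) (y * z).
have [h eg]: in_ideal z g.
  by apply: gmax; apply/in_ideal_mull/in_ideal_refl.
have dvd_h w : in_ideal g (w * z) -> in_ideal h w.
  case=> c; rewrite eg mulrA => /(mulIf z0) ->.
  exact/in_ideal_mull/in_ideal_refl.
have [c hc] := cop h (dvd_h _ gx) (dvd_h _ gy).
have: in_ideal x g by apply: gmax => //; apply/in_ideal_mulr/in_ideal_refl.
move/in_ideal_trans; apply.
by exists c; rewrite eg mulrA -hc mul1r.
Qed.

Lemma rel_primeM x y z : rel_prime x y -> rel_prime x z -> rel_prime x (y * z).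
Proof.
move=> xy [_ _ xz]; apply: rel_primeI => d dx dyz; apply: xz => //.
exact: rel_prime_gauss (rel_prime_dvdl dx xy) dyz.
Qed.

Lemma rel_prime_prod (I : Type) (s : seq I) (P : pred I) (F : I -> R) x :
  (forall i, P i -> rel_prime x (F i)) ->
  rel_prime x (\prod_(i <- s | P i) F i).
Proof.
move=> h; apply: (big_ind (rel_prime x)) => //.
  exact: rel_prime1.
by move=> ? ?; apply: rel_primeM.
Qed.

Lemma rel_prime_mul_dvd x y z :
  rel_prime x y -> in_ideal x z -> in_ideal y z -> in_ideal (x * y) z.
Proof.
move=> /rel_prime_sym xy [c ->]; rewrite mulrC => yxc.
have [e ->] := rel_prime_gauss xy yxc.
by exists e; rewrite mulrCA.
Qed.

Lemma pairwise_rel_prime_prod_dvd (I : finType) (F : I -> R) z :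
  (forall i j, i != j -> rel_prime (F i) (F j)) ->
  (forall i, in_ideal (F i) z) -> in_ideal (\prod_i F i) z.
Proof.
move=> cop dvd; have := index_enum_uniq I.
elim: (index_enum I) => [|i s IH] /=.
  by rewrite big_nil => _; apply: in_ideal1.
case/andP=> si us; rewrite big_cons; apply: rel_prime_mul_dvd _ (dvd i) (IH us).
rewrite big_seq; apply: rel_prime_prod => j js; apply: cop.
by apply: contraNneq si => ->.
Qed.

End Divisibility.

(** * Matrices of families of column vectors *)

Section Columns.
Variables (R : comNzRingType) (n : nat).
Implicit Types (B : 'I_n -> 'cV[R]_n) (f : 'cV[R]_n).

Lemma cols_mx_mul B (c : 'I_n -> R) :
  \sum_j c j *: B j = cols_mx B *m \col_j c j.
Proof.
apply/colP=> i; rewrite summxE !mxE; apply: eq_bigr => j _.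
by rewrite !mxE mulrC.
Qed.

(** The column form of Cramer's rule: expand the determinant of the modified
    family along the modified column. *)
Lemma adj_mul_col B f (j : 'I_n) :
  (\adj (cols_mx B) *m f) j 0
    = \det (cols_mx (fun l => if l == j then f else B l)).
Proof.
rewrite (expand_det_col _ j) mxE; apply: eq_bigr => i _.
rewrite !mxE eqxx mulrC; congr (_ * (_ * \det _)).
by apply/matrixP=> x y; rewrite !mxE eq_sym (negbTE (neq_lift _ _)).
Qed.

(** Subtracting row j from row i does not change the determinant and leaves a row
    with x as a common factor. *)
Lemma det_congr_rows (M : 'M[R]_n) (x : R) (i j : 'I_n) :
  i != j -> (forall l, in_ideal x (M i l - M j l)) -> in_ideal x (\det M).
Proof.
move=> ij /fin_all_exists[w hw].
pose repl (v : 'I_n -> R) : 'M[R]_n :=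
  \matrix_(s, l) if s == i then v l else M s l.
exists (\det (repl w)).
rewrite (determinant_multilinear (B := repl w) (C := repl (M j))
           (i0 := i) (b := x) (c := 1)).
- rewrite [\det (repl (M j))](determinant_alternate ij) ?mulr0 ?addr0 1?mulrC//.
  by move=> l; rewrite !mxE eqxx eq_sym (negbTE ij).
- by apply/rowP=> l; rewrite !mxE eqxx mul1r mulrC -hw subrK.
- by apply/matrixP=> s l; rewrite !mxE eq_sym (negbTE (neq_lift _ _)).
- by apply/matrixP=> s l; rewrite !mxE eq_sym (negbTE (neq_lift _ _)).
Qed.

Lemma det_generators_dvd (S : 'cV[R]_n -> Prop) B C :
  (forall f, S f -> exists c : 'I_n -> R, f = \sum_j c j *: B j) ->
  (forall j, S (C j)) -> in_ideal (\det (cols_mx B)) (\det (cols_mx C)).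
Proof.
move=> gen SC.
have /fin_all_exists[c hc] j := gen _ (SC j).
exists (\det (\matrix_(i, j) c j i)); rewrite mulrC -det_mulmx; congr (\det _).
apply/matrixP=> i j; rewrite !mxE hc summxE; apply: eq_bigr => l _.
by rewrite !mxE mulrC.
Qed.

End Columns.

(** * Determinants of families of splines *)

Section Splines.
Variables (R : idomainType) (n m : nat) (G : graph n m) (a : 'I_m -> R).

Lemma ends_joins (k : 'I_m) : exists p q : 'I_n, p != q /\ joins G k p q.
Proof.
have /eqP/cards2P[p [q [pq e]]] := card_ends G k.
by exists p, q; split=> //; apply/eqP.
Qed.

Lemma label_dvd_det (B : 'I_n -> 'cV[R]_n) k :
  (forall j, spline G a (B j)) -> in_ideal (a k) (\det (cols_mx B)).
Proof.
move=> hB; have [p [q [pq kpq]]] := ends_joins k.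
by apply: (det_congr_rows pq) => l; rewrite !mxE; apply: hB kpq.
Qed.

Lemma spline_const (c : R) : spline G a (const_mx c).
Proof. by move=> k i j _; rewrite !mxE subrr; apply: in_ideal0. Qed.

(** Along an edge that avoids v both values are 0. *)
Lemma spline_scale_delta (c : R) (v : 'I_n) :
  (forall k, v \in ends G k -> in_ideal (a k) c) ->
  spline G a (c *: delta_mx v 0).
Proof.
move=> hc k i j /eqP eij; rewrite !mxE !andbT.
have dvd w : w \in ends G k -> in_ideal (a k) (c * (w == v)%:R).
  move=> wk; have [ev|_] := eqVneq w v; last by rewrite mulr0; apply: in_ideal0.
  by apply: in_ideal_mulr; apply: hc; rewrite -ev.
by apply: in_idealB; apply: dvd; rewrite eij !inE eqxx ?orbT.
Qed.

Lemma det_scaled_deltas (c : R) :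
  \det (cols_mx (fun v : 'I_n => c *: delta_mx v 0)) = c ^+ n.
Proof.
rewrite -(det_scalar n c); congr (\det _); apply/matrixP=> i j.
by rewrite !mxE andbT mulr_natr.
Qed.

(** Row p of the matrix is a row of the identity, and deleting row and column p
    leaves a diagonal matrix. *)
Lemma det_const_and_deltas (p : 'I_n) (d : 'I_n -> R) : d p = 1 ->
  \det (cols_mx (fun v => if v == p then const_mx 1 else d v *: delta_mx v 0))
    = \prod_v d v.
Proof.
move=> dp.
pose E : 'M[R]_n := \matrix_(i, j) (if j == p then 1 else (i == j)%:R).
have -> : cols_mx (fun v => if v == p then const_mx 1 else d v *: delta_mx v 0)
    = E *m diag_mx (\row_v d v).
  apply/matrixP=> i j; rewrite mul_mx_diag !mxE.
  by have [->|_] := eqVneq j p; rewrite !mxE ?dp ?mulr1 // andbT mulrC.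
rewrite det_mulmx det_diag (expand_det_row _ p) (bigD1 p) //= big1 => [|j jp].
  rewrite addr0 mxE eqxx /cofactor addnn -signr_odd odd_double mul1r.
  have -> : row' p (col' p E) = 1%:M.
    apply/matrixP=> i j; rewrite !mxE eq_sym (negbTE (neq_lift _ _)).
    by rewrite (inj_eq lift_inj).
  by rewrite det1 !mul1r; apply: eq_bigr => v _; rewrite mxE.
by rewrite mxE (negbTE jp) eq_sym (negbTE jp) mul0r.
Qed.

Hypothesis hR : gcd_domain R.
Hypothesis ha0 : forall k, a k != 0.
Hypothesis hcop : forall k l, k != l -> rel_prime (a k) (a l).

Lemma prod_dvd_det (B : 'I_n -> 'cV[R]_n) :
  (forall j, spline G a (B j)) ->
  in_ideal (\prod_k a k) (\det (cols_mx B)).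
Proof.
by move=> hB; apply: pairwise_rel_prime_prod_dvd => // k; apply: label_dvd_det.
Qed.

(** In the test family for the edge k with ends p and q, the label a_k enters
    only through the column Q e_q: the constant spline replaces e_p, and the
    remaining columns are multiples of e_v with v off the edge k. *)
Lemma det_split_label k : exists2 C : 'I_n -> 'cV[R]_n,
  forall v, spline G a (C v)
  & exists2 N, rel_prime (a k) N & \det (cols_mx C) = a k * N.
Proof.
have [p [q [pq /eqP kpq]]] := ends_joins k.
pose P := \prod_(l | l != k) a l.
pose d v := if v == p then 1 else if v == q then a k * P else P.
exists (fun v => if v == p then const_mx 1 else d v *: delta_mx v 0).
  move=> v; have [vp|vp] := eqVneq v p; first exact: spline_const.
  apply: spline_scale_delta => l; rewrite /d (negbTE vp).
  have [vq _|vq vl] := eqVneq v q.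
    have [->|lk] := eqVneq l k; first exact/in_ideal_mulr/in_ideal_refl.
    exact/in_ideal_mull/in_ideal_prod.
  apply: in_ideal_prod; apply: contraTneq vl => ->.
  by rewrite kpq !inE (negbTE vp) (negbTE vq).
have copP : rel_prime (a k) P.
  by apply: rel_prime_prod => // l lk; apply: hcop; rewrite eq_sym.
exists (P * \prod_(v | v != q) d v).
  apply: rel_primeM => //; apply: rel_prime_prod => // v vq.
  by rewrite /d (negbTE vq); case: ifP => _; first exact: rel_prime1.
rewrite det_const_and_deltas; last by rewrite /d eqxx.
by rewrite (bigD1 q) //= {1}/d eq_sym (negbTE pq) eqxx mulrA.
Qed.

(** The determinant a_k N of the test family for k is a multiple of r a_k P, so
    r divides N, which is relatively prime to a_k. *)
Lemma basis_cofactor_rel_prime (B : 'I_n -> 'cV[R]_n) (r : R) k :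
  (forall f, spline G a f -> exists c : 'I_n -> R, f = \sum_j c j *: B j) ->
  \det (cols_mx B) = r * \prod_l a l -> rel_prime r (a k).
Proof.
move=> gen eD; have [C sC [N [_ _ copN] eC]] := det_split_label k.
have [x] := det_generators_dvd gen sC.
rewrite eC eD (bigD1 k) //= => eN.
have rN : in_ideal r N.
  exists (x * \prod_(l | l != k) a l); apply: (mulfI (ha0 k)).
  by rewrite eN [r * _]mulrC -!mulrA mulrCA.
by apply: rel_primeI => e er ea; apply: copN ea (in_ideal_trans er rN).
Qed.

End Splines.

Theorem theorem1p2 (R : idomainType) (hR : gcd_domain R)
    (n m : nat) (G : graph n m) (hG : connected G)
    (a : 'I_m -> R) (ha0 : forall k : 'I_m, a k != 0)
    (hcop : forall k l : 'I_m, k != l -> rel_prime (a k) (a l))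
    (B : 'I_n -> 'cV[R]_n) (hB : forall j : 'I_n, spline G a (B j)) :
  free_with_basis (spline G a) B <->
  exists2 u : R, u \is a GRing.unit & \det (cols_mx B) = u * \prod_(k < m) a k.
Proof.
set Q := \prod_(k < m) a k; have Q0 : Q != 0 by apply/prodf_neq0.
split=> [[_ _ gen]|[u uU eD]].
- have [r eD] := prod_dvd_det hR hcop hB; exists r => //.
  have sQ v : spline G a (Q *: delta_mx v 0).
    by apply: spline_scale_delta => k _; apply: in_ideal_prod.
  have [x] := det_generators_dvd gen sQ.
  rewrite det_scaled_deltas eD mulrCA => eQn.
  have rQn : in_ideal r (Q ^+ n).
    by rewrite eQn; apply/in_ideal_mulr/in_ideal_refl.
  have copQ : rel_prime r Q.
    by apply: rel_prime_prod => // k _; apply: basis_cofactor_rel_prime gen eD.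
  have [_ _ copQn] : rel_prime r (Q ^+ n).
    by rewrite -[n]card_ord -prodr_const; apply: rel_prime_prod.
  exact/in_ideal1_unit/(copQn r (in_ideal_refl r)).
- have D0 : \det (cols_mx B) != 0.
    by rewrite eD mulf_neq0 //; apply: contraTneq uU => ->; rewrite unitr0.
  split=> // [c | f sf].
    rewrite cols_mx_mul => /(congr1 (mulmx (\adj (cols_mx B)))).
    rewrite mulmxA mul_adj_mx mul_scalar_mx mulmx0 => /colP e j.
    by have /eqP := e j; rewrite !mxE mulf_eq0 (negbTE D0) => /eqP.
  (* Each coordinate of adj(B) f is the determinant of a family of splines. *)
  have /fin_all_exists[c hc] j : in_ideal Q ((\adj (cols_mx B) *m f) j 0).
    rewrite adj_mul_col; apply: (prod_dvd_det (G := G)) => // l.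
    by case: eqP.
  exists (fun j => u^-1 * c j); rewrite cols_mx_mul.
  have eadj : \adj (cols_mx B) *m f = (u * Q) *: \col_j (u^-1 * c j).
    by apply/colP=> j; rewrite hc !mxE mulrACA divrr // mul1r mulrC.
  have /(congr1 (mulmx (cols_mx B))) := eadj.
  rewrite mulmxA mul_mx_adj mul_scalar_mx -scalemxAr -eD => /colP e.
  by apply/colP=> i; have := e i; rewrite !mxE => /(mulfI D0).
Qed.
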